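(* For all integers $c \ge 1$ and $s \ge 2$ there exists a constant $C = C(c,s) > 0$ such that for every finite nilpotent group $G$ of nilpotency class $c$ and every symmetric generating set $S \subset G$ of size $s$, $$\operatorname{diam}(\Gamma(G^{\mathrm{ab}}, S)) \le \operatorname{diam}(\Gamma(G,S)) \le \operatorname{diam}(\Gamma(G^{\mathrm{ab}}, S)) + C\sqrt{\operatorname{diam}(\Gamma(G^{\mathrm{ab}}, S))}.$$
   Context: For a group $G$, the commutator is $[x,y]=xyx^{-1}y^{-1}$ and the lower central series is $G^{(1)}=G$, $G^{(i+1)}=[G,G^{(i)}]$ for $i\ge 1$. $G$ is nilpotent if $G^{(i)}=\{\mathrm{id}\}$ for some $i\ge 1$; its nilpotency class is then the smallest positive integer $c$ with $G^{(c+1)}=\{\mathrm{id}\}$. $G^{\mathrm{ab}}=G/G^{(2)}$ is the abelianisation. A generating set $S$ is symmetric if $S=S^{-1}$. $\Gamma(G,S)$ is the (undirected) Cayley graph of $G$ with respect to $S$, and its diameter is the largest graph distance between two vertices. $\Gamma(G^{\mathrm{ab}},S)$ denotes the Cayley graph of $G^{\mathrm{ab}}$ with respect to the images of the elements of $S$ in $G^{\mathrm{ab}}$. *)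

(* Defs.v *)
From mathcomp Require Import all_boot all_fingroup.

Set Implicit Arguments.
Unset Strict Implicit.
Unset Printing Implicit Defensive.

(* The index found in [iota 0 #|T|] is the length itself. A shortest walk
   visits each vertex at most once, so lengths below #|T| suffice; the junk
   value #|T| means that y is not reachable from x. *)
Definition gdist (T : finType) (e : rel T) (x y : T) : nat :=
  find (fun n => [exists p : n.-tuple T, path e x p && (last x p == y)])
       (iota 0 #|T|).

Lemma gdist_le (T : finType) (e : rel T) (x : T) (p : seq T) :
  path e x p -> (gdist e x (last x p) <= size p)%N.
Proof.
move=> ep; rewrite /gdist; set P := fun n => _.
have [pT|Tp] := ltnP (size p) #|T|; last first.
  by apply: leq_trans Tp; rewrite -[leqRHS](size_iota 0) find_size.
have Pp : P (size p).
  by apply/existsP; exists (in_tuple p); rewrite /= ep eqxx.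
rewrite leqNgt; apply/negP => /(before_find 0).
by rewrite nth_iota // add0n Pp.
Qed.

Lemma gdist_walk (T : finType) (e : rel T) (x y : T) :
  connect e x y ->
  exists p, [/\ path e x p, last x p = y & size p = gdist e x y].
Proof.
case/connectP=> p ep ->; case/shortenP: ep => q eq uq _.
set P := fun n => [exists r : n.-tuple T, path e x r && (last x r == last x q)].
have qT : (size q < #|T|)%N.
  by rewrite -[(size q).+1]/(size (x :: q)) -(card_uniqP uq) max_card.
have hP : has P (iota 0 #|T|).
  apply/hasP; exists (size q); first by rewrite mem_iota.
  by apply/existsP; exists (in_tuple q); rewrite /= eq eqxx.
have := nth_find 0 hP; rewrite nth_iota ?add0n; last first.
  by rewrite has_find size_iota in hP.
case/existsP=> r /andP[er /eqP lr]; exists r; split=> //.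
by rewrite size_tuple.
Qed.

Definition diam (T : finType) (V : {set T}) (e : rel T) : nat :=
  \max_(x in V) \max_(y in V) gdist e x y.

(* The undirected Cayley graph on the vertex set G. If 1 \in S it has loops,
   which do not affect distances. *)
Definition cayley (gT : finGroupType) (G S : {set gT}) : rel gT :=
  fun x y =>
    [&& x \in G, y \in G & (x^-1 * y \in S)%g || (y^-1 * x \in S)%g].

Definition cayley_diam (gT : finGroupType) (G S : {set gT}) : nat :=
  diam G (cayley G S).

(* Main.v *)
Require Import Defs.
From mathcomp Require Import all_boot all_order all_algebra all_fingroup all_solvable.
From mathcomp Require Import reals zify.

(** Let D be the diameter of the Cayley graph of the abelianisation and let m
    be an integer with D <= m ^ 2 and m <= 2 sqrt D. Every element of G is
    congruent modulo G' to a word of length at most D, so the upper bound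
    follows once every element of G' is a word of length O(m), with a constant
    that depends on c and s only. This is proved one layer 'L_i / 'L_i.+1 of
    the lower central series at a time, working modulo 'L_i.+1, where 'L_i is
    central.

    When [~: H, G] is central, h |-> [~ h, s] is a homomorphism on H, and every
    element of [~: H, G] is a product of commutators [~ h, s] with one factor
    for each generator s ([commg_gen_prod]). Only the class of h modulo the
    centre matters.
    - For the layer G' / 'L_3 a second collection follows: h may be taken a
      word of length at most D, and [~ h, s] is then the product over the
      generators t of powers [~ t, s] ^+ a with a <= D. Writing a = q m + r
      with q and r at most m gives
        [~ t, s] ^+ a = [~ t ^+ q, s ^+ m] * [~ t ^+ r, s],
      a word of length O(m) instead of O(D); this is the only source of the
      square root ([commX_ball], [lcn2_layer]).
    - For the deeper layers no new idea is needed: if h is a word of length n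
      modulo the next term of the series, then [~ h, s] is a word of length
      2 n + 2 modulo the term after it ([lcn_layer]).
    Summing the layers up to the nilpotency class gives [derived_ball].

    The lower bound holds because quotient maps do not increase word length. *)

Set Implicit Arguments.
Unset Strict Implicit.
Unset Printing Implicit Defensive.
Import Order.TTheory GRing.Theory Num.Theory.

(** * Word balls *)

(** The elements of word length at most n with respect to S: adjoining 1 to S
    turns the words of length at most n into those of length exactly n. *)
Definition ball (gT : finGroupType) (S : {set gT}) n : {set gT} :=
  ((1%g |: S) ^+ n)%g.

Section WordBalls.
Variable gT : finGroupType.
Implicit Types (S A K : {set gT}) (G H : {group gT}) (x y : gT).
Local Open Scope group_scope.

Lemma ball0 S : ball S 0 = 1. Proof. by []. Qed.

Lemma ballD S m n : ball S (m + n) = ball S m * ball S n.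
Proof. exact: expgD. Qed.

Lemma mem_ball1 S x : x \in S -> x \in ball S 1.
Proof. by rewrite /ball expg1 !inE orbC => ->. Qed.

Lemma one_mulg A S : 1 \in A -> 1 \in S -> 1 \in A * S.
Proof. by move=> A1 S1; apply/mulsgP; exists 1 1; rewrite ?mulg1. Qed.

Lemma ball_one S n : 1 \in ball S n.
Proof.
elim: n => [|n IHn]; first by rewrite ball0 set11.
by rewrite /ball expgS one_mulg ?setU11.
Qed.

Lemma ballS S m n : m <= n -> ball S m \subset ball S n.
Proof. by move/subnKC <-; rewrite ballD mulg_subl ?ball_one. Qed.

Lemma mem_ballM S m n x y :
  x \in ball S m -> y \in ball S n -> x * y \in ball S (m + n).
Proof. by rewrite ballD; apply: mem_mulg. Qed.

Lemma mem_ballX S n x k : x \in ball S n -> x ^+ k \in ball S (k * n).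
Proof.
move=> Bx; elim: k => [|k IHk]; first exact: ball_one.
by rewrite expgS mulSn mem_ballM.
Qed.

Lemma mem_ballV S n x : S^-1 = S -> x \in ball S n -> x^-1 \in ball S n.
Proof.
move=> SV; elim: n x => [|n IHn] x.
  by rewrite ball0 => /set1P->; rewrite invg1 set11.
rewrite {1}/ball expgS => /mulsgP[a y Aa By ->]; rewrite invMg -addn1.
rewrite mem_ballM ?IHn // /ball expg1.
by case/setU1P: Aa => [->|Sa]; rewrite ?invg1 ?setU11 // setU1r // -SV inE invgK.
Qed.

Lemma mem_ballR S m n x y : S^-1 = S ->
  x \in ball S m -> y \in ball S n -> [~ x, y] \in ball S ((m + n).*2).
Proof.
move=> SV Bx By; rewrite -addnn commgEl /conjg -addnA.
by rewrite !mem_ballM ?mem_ballV ?mem_ballM.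
Qed.

Lemma ball_sub S G n : S \subset G -> ball S n \subset G.
Proof.
move=> sSG; elim: n => [|n IHn]; first by rewrite ball0 sub1G.
by rewrite /ball expgS mul_subG // subUset sub1G.
Qed.

Lemma ball_prod S (I : eqType) (l : seq I) (F : I -> {set gT}) n :
  {in l, forall i, F i \subset ball S n} ->
  \prod_(i <- l) F i \subset ball S (size l * n).
Proof.
elim: l => [|i l IHl] sFB; first by rewrite big_nil sub1set ball_one.
rewrite big_cons mulSn ballD mulgSS ?sFB ?mem_head // IHl // => j lj.
by rewrite sFB // inE lj orbT.
Qed.

Lemma quotient_ball S H n : S \subset 'N(H) -> ball S n / H = ball (S / H) n.
Proof.
move=> nHS; elim: n => [|n IHn]; first by rewrite /ball quotient1.
have nHA : 1 |: S \subset 'N(H) by rewrite subUset sub1G.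
rewrite /ball expgS quotientMl // -/(ball S n) IHn expgS.
by rewrite quotientU quotient1.
Qed.

Lemma prod_subset (I : eqType) (l : seq I) (F F' : I -> {set gT}) :
  {in l, forall i, F i \subset F' i} ->
  \prod_(i <- l) F i \subset \prod_(i <- l) F' i.
Proof.
elim: l => [|i l IHl] sF; first by rewrite !big_nil.
rewrite !big_cons mulgSS ?sF ?mem_head // IHl // => j lj.
by rewrite sF // inE lj orbT.
Qed.

(** How a product with one factor for each index, as opposed to one factor for
    each letter of a word, is built up: a new factor that commutes with all the
    others moves to the place of its own index t and merges there. Enlarging F
    to F' leaves room for the merged factor. *)
Lemma absorb_prod (I : eqType) (l : seq I) (F F' : I -> {set gT}) t x y :
  t \in l -> {in l, forall i, x \in 'C(F i)} ->
  {in F t, forall z, x * z \in F' t} ->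
  {in l, forall i, F i \subset F' i} ->
  y \in \prod_(i <- l) F i -> x * y \in \prod_(i <- l) F' i.
Proof.
move=> lt cF xF sF; elim: l lt cF sF y => // i l IHl lt cF sF y.
rewrite !big_cons => /mulsgP[u v Fu Fv ->].
have sFl: {in l, forall j, F j \subset F' j}.
  by move=> j lj; apply: sF; rewrite inE lj orbT.
move: lt; rewrite inE => /predU1P[ti | lt].
  subst i; rewrite mulgA mem_mulg ?xF //.
  exact: subsetP (prod_subset sFl) v Fv.
have /centP/(_ u Fu) cxu := cF i (mem_head _ _).
rewrite mulgA cxu -mulgA mem_mulg ?(subsetP (sF i _)) ?mem_head //.
by rewrite IHl // => j lj; apply: cF; rewrite inE lj orbT.
Qed.

(** * Commutators with central values *)

Lemma commMg_central G x y z : x \in G -> y \in G -> z \in G ->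
  [~ x, z] \in 'C(G) -> [~ x * y, z] = [~ x, z] * [~ y, z].
Proof.
by move=> Gx Gy Gz /centP cxz; rewrite commMgJ /conjg cxz // mulKg.
Qed.

(** One commutator for each generator suffices, however long the element of
    [~: H, G] is as a product of commutators, since [~ h, s] * [~ k, s] is
    again a commutator with s. That arbitrary elements of G may be replaced by
    generators holds because [~: H, S] is central, hence normal, and modulo it
    H centralises S and so all of G. *)
Lemma commg_gen_prod S G H :
  <<S>> = G -> H \subset G -> [~: H, G] \subset 'C(G) ->
  [~: H, G] \subset \prod_(s <- enum S) [set [~ h, s] | h in H].
Proof.
move=> genS sHG cHG.
have sSG : S \subset G by rewrite -genS subset_gen.
have sHS : [~: H, S] \subset [~: H, G] by rewrite commgS.
have nS : G \subset 'N([~: H, S]).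
  by rewrite cents_norm // centsC (subset_trans sHS).
have sHGS : [~: H, G] \subset [~: H, S].
  rewrite -quotient_cents2 // ?(subset_trans sHG) // -{1}genS.
  rewrite quotient_gen ?(subset_trans sSG) // cent_gen quotient_cents2 //.
    by rewrite (subset_trans sHG).
  by rewrite (subset_trans sSG).
apply: subset_trans sHGS _; apply/subsetP=> _ /gen_prodgP[n [c Rc ->]].
elim: n c Rc => [|n IHn] c Rc.
  rewrite big_ord0; elim: (enum S) => [|s l IHl]; first by rewrite big_nil set11.
  rewrite big_cons one_mulg //; apply/imsetP; exists 1 => //.
  by rewrite comm1g.
rewrite big_ord_recl; case/imset2P: (Rc ord0) => h s Hh Ss ->.
have cR k r : k \in H -> r \in G -> [~ k, r] \in 'C(G).
  by move=> Hk Gr; rewrite (subsetP cHG) // mem_commg.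
apply: (absorb_prod (t := s)); rewrite ?mem_enum //; last exact: IHn.
- move=> r; rewrite mem_enum => Sr.
  rewrite (subsetP (centS _) _ (cR _ _ Hh (subsetP sSG _ Ss))) //.
  apply/subsetP=> _ /imsetP[k Hk ->].
  by rewrite groupR ?(subsetP sHG k) ?(subsetP sSG r).
- move=> _ /imsetP[k Hk ->]; apply/imsetP; exists (h * k); rewrite ?groupM //.
  have [Gh Gk] := (subsetP sHG h Hh, subsetP sHG k Hk).
  by rewrite (@commMg_central G) ?cR ?(subsetP sSG s).
- by move=> r _; apply: subxx.
Qed.

(** Each of the #|S| factors [~ h, s] depends on h modulo the centre only, so h
    may be replaced by a word of length n. *)
Lemma commg_layer_central S G H K n : S^-1 = S -> <<S>> = G ->
  H \subset G -> [~: H, G] \subset 'C(G) ->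
  K \subset 'C(G) -> H \subset K * ball S n ->
  [~: H, G] \subset ball S (#|S| * (n.+1).*2).
Proof.
move=> SV genS sHG cHG cK sHB.
have sSG : S \subset G by rewrite -genS subset_gen.
apply: subset_trans (commg_gen_prod genS sHG cHG) _; rewrite cardE.
apply: ball_prod => s; rewrite mem_enum => Ss; apply/subsetP=> _ /imsetP[h Hh ->].
have /mulsgP[z b Kz Bb ->] := subsetP sHB _ Hh.
have cz := subsetP cK _ Kz; have Gs := subsetP sSG _ Ss.
have zs1 : [~ z, s] = 1 by apply/eqP/commgP/(centP cz).
by rewrite commMgJ zs1 conj1g mul1g -addn1 mem_ballR // mem_ball1.
Qed.

(** The letters of the word b can be collected: [~ b, s] depends only on how
    often each generator occurs in b, which is at most n times. *)
Lemma commg_ball_prod S G s n b :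
  <<S>> = G -> [~: G, G] \subset 'C(G) -> s \in S -> b \in ball S n ->
  [~ b, s] \in \prod_(t <- enum S) [set [~ t, s] ^+ a | a : 'I_n.+1].
Proof.
move=> genS cG Ss; have sSG : S \subset G by rewrite -genS subset_gen.
have Gs := subsetP sSG s Ss; elim: n b => [|n IHn] b.
  rewrite ball0 => /set1P->; rewrite comm1g.
  elim: (enum S) => [|t l IHl]; first by rewrite big_nil set11.
  by rewrite big_cons one_mulg //; apply/imsetP; exists ord0.
have cR x y : x \in G -> y \in G -> [~ x, y] \in 'C(G).
  by move=> Gx Gy; rewrite (subsetP cG) // mem_commg.
have sF t : [set [~ t, s] ^+ a | a : 'I_n.+1] \subset
            [set [~ t, s] ^+ a | a : 'I_n.+2].
  apply/subsetP=> _ /imsetP[a _ ->]; apply/imsetP.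
  by exists (widen_ord (leqnSn _) a).
rewrite {1}/ball expgS => /mulsgP[t c At Bc ->].
have Gt : t \in G by move: At; rewrite 2!inE => /predU1P[->|/(subsetP sSG)].
have Gc := subsetP (ball_sub n sSG) c Bc.
rewrite (@commMg_central G) ?cR //.
case/setU1P: At => [->|St].
  by rewrite comm1g mul1g; apply: subsetP (IHn c Bc); apply: prod_subset.
apply: (absorb_prod (t := t)); rewrite ?mem_enum //; last exact: IHn.
- move=> r; rewrite mem_enum => Sr.
  rewrite (subsetP (centS _) _ (cR _ _ Gt Gs)) //.
  apply/subsetP=> _ /imsetP[a _ ->].
  by rewrite groupX // groupR // (subsetP sSG r).
- move=> _ /imsetP[a _ ->]; rewrite -expgS; apply/imsetP.
  by exists (lift ord0 a).
- by move=> r _; apply: sF.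
Qed.

(** The power a of [~ t, s], naively a word of length 4 a, has length of the
    order of the square root of a, because the commutator is bilinear. *)
Lemma commX_ball S G t s m a : S^-1 = S -> S \subset G ->
  [~: G, G] \subset 'C(G) -> t \in S -> s \in S -> a <= m * m ->
  [~ t, s] ^+ a \in ball S (8 * m).
Proof.
move=> SV sSG cG St Ss le_a_mm.
have [m0|m_gt0] := posnP m.
  by move: le_a_mm; rewrite m0 leqn0 => /eqP->; rewrite expg0 ball_one.
have Gt := subsetP sSG t St; have Gs := subsetP sSG s Ss.
have /centP cts : [~ t, s] \in 'C(G) by rewrite (subsetP cG) ?mem_commg.
have q_le : a %/ m <= m by rewrite -[leqRHS](mulnK m m_gt0) leq_div2r.
have r_lt : a %% m < m by rewrite ltn_mod.
have Bt := mem_ball1 St; have Bs := mem_ball1 Ss.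
(* The four parts have lengths q, m, r and 1, each at most m, and a
   commutator doubles the total length. *)
have ct : commute t [~ t, s] by apply/commute_sym/cts.
have cs : commute s [~ t, s] by apply/commute_sym/cts.
rewrite {1}(divn_eq a m) expgD -commXXg // -commXg //.
have := mem_ballM (mem_ballR SV (mem_ballX (a %/ m) Bt) (mem_ballX m Bs))
                  (mem_ballR SV (mem_ballX (a %% m) Bt) Bs).
apply: subsetP; apply: ballS; lia.
Qed.

Lemma derived_layer_central S G K n m : S^-1 = S -> <<S>> = G ->
  [~: G, G] \subset 'C(G) -> K \subset 'C(G) ->
  G \subset K * ball S n -> n <= m * m ->
  [~: G, G] \subset ball S (#|S| * (#|S| * (8 * m))).
Proof.
move=> SV genS cG cK sGB le_n_mm.
have sSG : S \subset G by rewrite -genS subset_gen.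
apply: subset_trans (commg_gen_prod genS (subxx G) cG) _; rewrite cardE.
apply: ball_prod => s; rewrite mem_enum => Ss; apply/subsetP=> _ /imsetP[h Gh ->].
have /mulsgP[z b Kz Bb ->] := subsetP sGB _ Gh.
have cz := subsetP cK _ Kz; have Gs := subsetP sSG _ Ss.
have zs1 : [~ z, s] = 1 by apply/eqP/commgP/(centP cz).
rewrite commMgJ zs1 conj1g mul1g.
apply: subsetP (commg_ball_prod genS cG Ss Bb); apply: ball_prod => t.
rewrite mem_enum => St; apply/subsetP=> _ /imsetP[a _ ->].
by rewrite (commX_ball SV sSG cG St Ss) // (leq_trans _ le_n_mm) // -ltnS.
Qed.

End WordBalls.

(** * Layers of the lower central series *)

Section LowerCentralLayers.
Variable gT : finGroupType.
Implicit Types (S : {set gT}) (G : {group gT}).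
Local Open Scope group_scope.

(** This is [commg_layer_central] in G / 'L_i.+3(G), where the image of
    'L_i.+2(G) is central: from one layer to the next, word length grows by a
    factor bounded in terms of #|S|. *)
Lemma lcn_layer S G i n : S^-1 = S -> <<S>> = G ->
  'L_i.+1(G) \subset 'L_i.+2(G) * ball S n ->
  'L_i.+2(G) \subset 'L_i.+3(G) * ball S (#|S| * n.+1.*2).
Proof.
move=> SV genS sLB; have sSG : S \subset G by rewrite -genS subset_gen.
have nL j : 'L_j(G) \subset 'N('L_i.+3(G)).
  by rewrite (subset_trans (lcn_sub j G)) ?lcn_norm.
have nG := lcn_norm i.+3 G.
have nS := subset_trans sSG nG.
rewrite -quotientSK // quotient_ball //.
have cen j : 'L_j.+2(G) / 'L_i.+3(G) =
             [~: 'L_j.+1(G) / 'L_i.+3(G), G / 'L_i.+3(G)].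
  by rewrite (lcnSn j) quotientR.
have cL : 'L_i.+2(G) / 'L_i.+3(G) \subset 'C(G / 'L_i.+3(G)).
  by rewrite quotient_cents2r // -lcnSn.
have le_S : #|S / 'L_i.+3(G)| <= #|S| := leq_morphim _ _.
rewrite cen.
apply: subset_trans _ (ballS _ (leq_mul le_S (leqnn n.+1.*2))).
apply: (@commg_layer_central _ _ _ _ ('L_i.+2(G) / 'L_i.+3(G))) => //.
  - by rewrite -quotientV SV.
  - by rewrite -quotient_gen // genS.
  - by rewrite quotientS ?lcn_sub.
  - by rewrite -cen.
  - by rewrite -quotient_ball // -quotientMl // quotientS.
Qed.

(** The layer in which the square root appears: words of length n in G yield
    words of length O(m) in its derived subgroup, where n <= m ^ 2. *)
Lemma lcn2_layer S G n m : S^-1 = S -> <<S>> = G ->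
  G \subset 'L_2(G) * ball S n -> n <= m * m ->
  'L_2(G) \subset 'L_3(G) * ball S (#|S| * (#|S| * (8 * m))).
Proof.
move=> SV genS sLB le_n_mm; have sSG : S \subset G by rewrite -genS subset_gen.
have nG := lcn_norm 3 G; have nL := subset_trans (lcn_sub 2 G) nG.
have nS := subset_trans sSG nG.
rewrite -quotientSK // quotient_ball //.
have cen : 'L_2(G) / 'L_3(G) = [~: G / 'L_3(G), G / 'L_3(G)].
  by rewrite (lcnSn 0) lcn1 quotientR.
have cL : 'L_2(G) / 'L_3(G) \subset 'C(G / 'L_3(G)).
  by rewrite quotient_cents2r // -lcnSn.
have le_S : #|S / 'L_3(G)| <= #|S| := leq_morphim _ _.
rewrite cen.
apply: subset_trans _ (ballS _ (leq_mul le_S (leq_mul le_S (leqnn (8 * m))))).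
apply: (@derived_layer_central _ _ _ ('L_2(G) / 'L_3(G)) n) => //.
- by rewrite -quotientV SV.
- by rewrite -quotient_gen // genS.
- by rewrite -cen.
- by rewrite -quotient_ball // -quotientMl // quotientS.
Qed.
End LowerCentralLayers.

(** The factor of m in the word length needed for 'L_i.+2 modulo 'L_i.+3: the
    base case is the constant of [lcn2_layer], and the step is that of
    [lcn_layer] with the summand 2 absorbed by m >= 1. *)
Fixpoint layer_const s i :=
  if i is i'.+1 then (s * (layer_const s i').+1.*2)%N else (s * (s * 8))%N.

Section Layers.
Variables (gT : finGroupType) (S : {set gT}) (G : {group gT}) (n m : nat).
Hypotheses (SV : (S^-1 = S)%g) (genS : (<<S>> = G)%g).
Hypotheses (sGB : G \subset ('L_2(G) * ball S n)%g).
Hypotheses (m_gt0 : 0 < m) (le_n_mm : n <= m * m).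
Local Open Scope group_scope.

Lemma lcn_layer_ball i :
  'L_i.+2(G) \subset 'L_i.+3(G) * ball S (layer_const #|S| i * m).
Proof.
elim: i => [|i IHi] /=.
  by rewrite -!mulnA; apply: lcn2_layer sGB _.
apply: subset_trans (lcn_layer SV genS IHi) _; rewrite mulgS // ballS //.
rewrite -mulnA leq_mul2l -doubleMl leq_double mulSn -add1n.
by rewrite leq_add2r m_gt0 orbT.
Qed.

(** Telescoping the layers; they stop at a trivial term of the series. *)
Lemma derived_ball c : 'L_c.+1(G) = 1 -> 
  'L_2(G) \subset ball S ((\sum_(i < c) layer_const #|S| i) * m).
Proof.
move=> Lc1; suff sLB k : 'L_2(G) \subset
    'L_k.+2(G) * ball S ((\sum_(i < k) layer_const #|S| i) * m).
  have Lc2 : 'L_c.+2(G) = 1 by apply/trivgP; rewrite /= -Lc1 lcn_subS.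
  by have:= sLB c; rewrite Lc2 mul1g.
elim: k => [|k IHk]; first by rewrite mulg_subl ?ball_one.
apply: subset_trans IHk _.
rewrite big_ord_recr /= addnC mulnDl ballD mulgA.
exact: mulSg (lcn_layer_ball k).
Qed.
End Layers.

(** * Diameters of Cayley graphs *)

Section CayleyBalls.
Variables (gT : finGroupType) (S : {set gT}) (G : {group gT}).
Hypotheses (SV : (S^-1 = S)%g) (genS : (<<S>> = G)%g).
Local Open Scope group_scope.

Let sSG : S \subset G. Proof. by rewrite -genS subset_gen. Qed.

Lemma cayleyE x y : x \in G -> cayley G S x y = (x^-1 * y \in S).
Proof.
move=> Gx; rewrite /cayley Gx /=.
have -> : (y^-1 * x \in S) = (x^-1 * y \in S).
  by rewrite -[in LHS]SV inE invMg invgK.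
rewrite orbb; case Sxy: (x^-1 * y \in S); last by rewrite andbF.
by rewrite -(groupMl _ (groupVr Gx)) (subsetP sSG).
Qed.

Lemma path_ball x p : x \in G -> path (cayley G S) x p ->
  x^-1 * last x p \in ball S (size p).
Proof.
elim: p x => [|y p IHp] x Gx /=; first by rewrite mulVg ball_one.
rewrite cayleyE // => /andP[Sxy pyp].
have Gy : y \in G by rewrite -(groupMl _ (groupVr Gx)) (subsetP sSG).
by rewrite -(mulKVg y (last y p)) mulgA -add1n mem_ballM ?mem_ball1 ?IHp.
Qed.

(** A letter 1 of the word is skipped, as it need not be an edge; hence only an
    inequality on the length of the path. *)
Lemma ball_path n x z : x \in G -> z \in ball S n ->
  exists p, [/\ path (cayley G S) x p, last x p = x * z & size p <= n].
Proof.
elim: n x z => [|n IHn] x z Gx.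
  by rewrite ball0 => /set1P->; exists [::]; rewrite mulg1.
rewrite {1}/ball expgS => /mulsgP[a b /setU1P[->|Sa] Bb ->].
  by have [p [? ? ?]] := IHn x b Gx Bb; exists p; rewrite mul1g leqW.
have Gxa : x * a \in G by rewrite groupM // (subsetP sSG).
have [p [xp lp sp]] := IHn (x * a) b Gxa Bb.
by exists (x * a :: p); rewrite /= cayleyE // mulKg Sa mulgA.
Qed.

Lemma gdist_cayley_le n x y :
  x \in G -> x^-1 * y \in ball S n -> gdist (cayley G S) x y <= n.
Proof.
move=> Gx /(ball_path Gx)[p [xp]]; rewrite mulKVg => <-.
exact/leq_trans/gdist_le.
Qed.

Lemma ball_exhausts y : y \in G -> exists n, y \in ball S n.
Proof.
rewrite -genS => /gen_prodgP[n [c Sc ->]]; exists n.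
elim: n c Sc => [|n IHn] c Sc; first by rewrite big_ord0 ball_one.
rewrite big_ord_recl; apply: (@mem_ballM _ _ 1 n); first exact: mem_ball1.
exact: IHn.
Qed.

(** Connectedness matters here: the value of [gdist] on a pair of unconnected
    vertices would say nothing about word length. *)
Lemma mem_ball_gdist x y :
  x \in G -> y \in G -> x^-1 * y \in ball S (gdist (cayley G S) x y).
Proof.
move=> Gx Gy; have Gxy : x^-1 * y \in G by rewrite groupM ?groupV.
have [n /(ball_path Gx)[p [xp lp _]]] := ball_exhausts Gxy.
have /gdist_walk[q [xq lq <-]] : connect (cayley G S) x y.
  by apply/connectP; exists p; rewrite // lp mulKVg.
by rewrite -lq path_ball.
Qed.

(** The Cayley graph is vertex-transitive, so distances from 1 determine the
    diameter. *)
Lemma cayley_diam_leP n : reflect (G \subset ball S n) (cayley_diam G S <= n).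
Proof.
apply: (iffP idP) => [le_n | sGB]; last first.
  apply/bigmax_leqP=> x Gx; apply/bigmax_leqP=> y Gy.
  by rewrite gdist_cayley_le // (subsetP sGB) // groupM ?groupV.
apply/subsetP=> y Gy; rewrite -(mul1g y) -invg1.
apply: subsetP (mem_ball_gdist (group1 G) Gy); apply/ballS/(leq_trans _ le_n).
apply: leq_trans (leq_bigmax_cond 1 (group1 G)).
exact: (leq_bigmax_cond y Gy).
Qed.
End CayleyBalls.

Section AbelianisationDiameter.
Variables (gT : finGroupType) (S : {set gT}) (G : {group gT}).
Hypotheses (SV : (S^-1 = S)%g) (genS : (<<S>> = G)%g).
Local Open Scope group_scope.
Let Dab := cayley_diam (G / G^`(1)) (S / G^`(1)).

Let nG : G \subset 'N(G^`(1)) := der_norm 1 G.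
Let nS : S \subset 'N(G^`(1)).
Proof. by apply: subset_trans nG; rewrite -genS subset_gen. Qed.
Let SabV : (S / G^`(1))^-1 = S / G^`(1). Proof. by rewrite -quotientV SV. Qed.
Let genSab : <<S / G^`(1)>> = (G / G^`(1))%G.
Proof. by rewrite -quotient_gen // genS. Qed.

Lemma cayley_diam_ab_le : Dab <= cayley_diam G S.
Proof.
apply/(cayley_diam_leP SabV genSab); rewrite -quotient_ball // quotientS //.
exact/(cayley_diam_leP SV genS).
Qed.

Lemma cover_diam_ab : G \subset 'L_2(G) * ball S Dab.
Proof.
rewrite lcn2 -quotientSK // quotient_ball //.
exact/(cayley_diam_leP SabV genSab).
Qed.

(** A nontrivial nilpotent group is not perfect. Positivity is what allows an
    additive constant to be absorbed into a multiple of the square root. *)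
Lemma diam_ab_gt0 : nilpotent G -> G :!=: 1 -> 0 < Dab.
Proof.
move=> nilG ntG; rewrite lt0n; apply: contraNneq ntG => D0.
have := cover_diam_ab; rewrite D0 ball0 mulg1 lcn2 => sGG'.
apply: contraTT isT => ntG.
have := sol_der1_proper (nilpotent_sol nilG) (subxx G) ntG.
by rewrite properE sGG' andbF.
Qed.
End AbelianisationDiameter.

(** An integer m with sqrt d <= m <= 2 sqrt d, in terms of squares. *)
Lemma square_between d : (0 < d)%N ->
  exists m, [/\ 0 < m, d <= m * m & m * m <= 4 * d]%N.
Proof.
elim: d => // -[_ _|d /(_ isT)[m [m_gt0 le_dm le_md]] _]; first by exists 1%N.
by have [le_d2m|lt_md] := leqP d.+2 (m * m); [exists m | exists m.+1]; split; nia.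
Qed.

(** * The comparison of diameters *)

Local Open Scope ring_scope.

Theorem corollary2p1 (R : realType) (c s : nat) (hc : (1 <= c)%N) (hs : (2 <= s)%N) :
  exists C : R, 0 < C /\
    forall (gT : finGroupType) (G : {group gT}) (S : {set gT}),
      nilpotent G -> nil_class G = c ->
      S \subset G -> <<S>>%g = G -> S^-1%g = S -> #|S| = s ->
      let D := cayley_diam G S in
      let Dab := cayley_diam (G / G^`(1))%g (S / G^`(1))%g in
      (Dab <= D)%N /\ D%:R <= Dab%:R + C * Num.sqrt (Dab%:R : R).
Proof.
pose K := (\sum_(i < c) layer_const s i)%N.
(* The factor 2 is that of m <= 2 sqrt Dab; the summand 1 makes the constant
   positive when K is zero. *)
exists (K%:R * 2 + 1); split; first by rewrite ltr_wpDl ?mulr_ge0.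
move=> gT G S nilG cG _ genS SV cardS D Dab; split; first exact: cayley_diam_ab_le.
have ntG : G :!=: 1%g by rewrite -nil_class0 cG -lt0n.
have [m [m_gt0 le_dm le_md]] := square_between (diam_ab_gt0 SV genS nilG ntG).
have Lc1 : ('L_c.+1(G) = 1)%g by apply/lcn_nil_classP; rewrite ?cG.
have sGB := cover_diam_ab SV genS.
have le_D : (D <= K * m + Dab)%N.
  apply/(cayley_diam_leP SV genS); apply: subset_trans sGB _.
  rewrite ballD mulSg // /K -cardS.
  exact: derived_ball SV genS (cover_diam_ab SV genS) m_gt0 le_dm _ Lc1.
have le_m : m%:R <= 2 * Num.sqrt (Dab%:R : R).
  rewrite -(ger0_norm (ler0n R m)) -sqrtr_sqr.
  rewrite -(ger0_norm (ler0n R 2)) -sqrtr_sqr -sqrtrM ?sqr_ge0 //.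
  by rewrite ler_wsqrtr // -!natrX -natrM ler_nat -mulnn.
rewrite (le_trans (_ : _ <= (K * m + Dab)%:R)) ?ler_nat //.
rewrite natrD natrM addrC lerD2l mulrDl mul1r -mulrA.
by rewrite ler_wpDr ?sqrtr_ge0 // ler_wpM2l.
Qed.
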